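(* Let $K$ be a field, let $M$ be a matroid on $E=[d]$, and let $c\in E$ be an element that is not a coloop of $M$. Number the bases of $M$ as $B_1,\dots,B_n$ so that $c\notin B_j$ for $j\in[\gamma]$ and $c\in B_j$ for $j\in[n]\setminus[\gamma]$. Let $M+_c(d+1)$ be the series extension of $M$ at $c$ by $d+1$, and identify its toric ideal with an ideal of $K[x^1_1,\dots,x^1_n,x^2_1,\dots,x^2_\gamma]$ by letting $x^1_j$ correspond to the basis $B_j\cup\{d+1\}$ ($j\in[n]$) and $x^2_j$ correspond to the basis $B_j\cup\{c\}$ ($j\in[\gamma]$). If $\mathbf F$ is a generating set (resp. a Gr\''obner basis with respect to some monomial order) consisting of homogeneous binomials of $J_M\subset K[x^1_1,\dots,x^1_n]$, then the set $\widetilde{\mathbf F}$ described in the context is a generating set (resp. a Gr\''obner basis with respect to some monomial order) of $J_{M+_c(d+1)}$.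
   Context: For a matroid $N$ on a finite set with bases $C_1,\dots,C_m$, its toric ideal $J_N$ is the kernel of the $K$-algebra map $K[x_1,\dots,x_m]\to K[s_e: e\text{ in the ground set}]$, $x_j\mapsto\prod_{e\in C_j}s_e$. The series extension $M+_c(d+1)$ of a matroid $M$ on $[d]$ at $c$ by $d+1$ is the matroid on $[d+1]$ whose bases are $\{B\cup\{d+1\}: B \text{ a basis of } M\}\cup\{B\cup\{c\}: B \text{ a basis of } M,\ c\notin B\}$. Construction of $\widetilde{\mathbf F}$ (with $J_M\subset K[x^1_1,\dots,x^1_n]$, $x^1_j\leftrightarrow B_j$): each $f\in\mathbf F$ is written as $f=\prod_{l=1}^{u_f}x^1_{j_l}\prod_{l=1}^{v_f}x^1_{k_l}-\prod_{l=1}^{u'_f}x^1_{j'_l}\prod_{l=1}^{v'_f}x^1_{k'_l}$ with $j_l,j'_l\in[\gamma]$ and $k_l,k'_l\in[n]\setminus[\gamma]$ (factors listed in a fixed order); necessarily $u_f=u'_f$ and $v_f=v'_f$. For $I=(i_1,\dots,i_{u_f})\in\{1,2\}^{u_f}$ put $f^I=\prod_{l=1}^{u_f}x^{i_l}_{j_l}\prod_{l=1}^{v_f}x^1_{k_l}-\prod_{l=1}^{u_f}x^{i_l}_{j'_l}\prod_{l=1}^{v_f}x^1_{k'_l}$. Then $\widetilde{\mathbf F}=\{f^I: f\in\mathbf F,\ I\in\{1,2\}^{u_f}\}\cup\{x^1_{j_2}x^2_{j_1}-x^1_{j_1}x^2_{j_2}: 1\le j_1<j_2\le\gamma\}$.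 *)

(* Defs.v *)
From mathcomp Require Import all_boot all_order all_algebra.
From mathcomp Require Import mpoly.

Set Implicit Arguments.
Unset Strict Implicit.
Unset Printing Implicit Defensive.

Import GRing.Theory.
Local Open Scope ring_scope.

Record matroid (T : finType) := Matroid {
  bases : {set {set T}};
  bases_neq0 : bases != set0;
  basis_exchange : forall (B1 B2 : {set T}) (x : T),
    B1 \in bases -> B2 \in bases -> x \in B1 :\: B2 ->
    exists2 y, y \in B2 :\: B1 & (y |: (B1 :\ x)) \in bases
}.

Definition coloop (T : finType) (M : matroid T) (c : T) : Prop :=
  forall B, B \in bases M -> c \in B.

Record numbering (T : finType) (M : matroid T) (n : nat) := Numbering {
  basis_of :> 'I_n -> {set T};
  basis_of_inj : injective basis_of;
  basis_of_codom : [set basis_of j | j : 'I_n] = bases M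
}.

Section SeriesExtension.
Variable d : nat.

(* [d] sits inside [d+1] as the ordinals below [ord_max]; the new element
   d+1 is [ord_max]. *)
Definition old (e : 'I_d) : 'I_d.+1 := widen_ord (leqnSn d) e.
Definition new : 'I_d.+1 := ord_max.

Definition ext_new (B : {set 'I_d}) : {set 'I_d.+1} := new |: (old @: B).
Definition ext_at (c : 'I_d) (B : {set 'I_d}) : {set 'I_d.+1} :=
  old c |: (old @: B).

Lemma old_inj : injective old.
Proof. by move=> x y /(congr1 val) /= h; apply: val_inj. Qed.

Lemma old_neq_new e : (old e == new) = false.
Proof. by apply/negbTE; rewrite -val_eqE /= neq_ltn ltn_ord. Qed.

Lemma mem_old e (B : {set 'I_d}) : (old e \in old @: B) = (e \in B).
Proof. exact/mem_imset/old_inj. Qed.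

Lemma mem_new (B : {set 'I_d}) : (new \in old @: B) = false.
Proof. by apply/imsetP => -[e _ /eqP]; rewrite eq_sym old_neq_new. Qed.

Variant ord_spec : 'I_d.+1 -> Type :=
  | OrdOld e : ord_spec (old e)
  | OrdNew : ord_spec new.

Lemma ordP x : ord_spec x.
Proof.
case: (unliftP ord_max x) => [e ->|->]; last exact: OrdNew.
have -> : lift ord_max e = old e by apply: val_inj; exact: lift_max.
exact: OrdOld.
Qed.

Lemma in_ext_new_old e B : (old e \in ext_new B) = (e \in B).
Proof. by rewrite !inE old_neq_new mem_old. Qed.
Lemma in_ext_new_new B : new \in ext_new B.
Proof. by rewrite !inE eqxx. Qed.
Lemma in_ext_at_old c e B : (old e \in ext_at c B) = (e == c) || (e \in B).
Proof. by rewrite !inE mem_old (inj_eq old_inj). Qed.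
Lemma in_ext_at_new c B : (new \in ext_at c B) = false.
Proof. by rewrite !inE mem_new eq_sym old_neq_new. Qed.

Definition extE := (in_ext_new_old, in_ext_new_new, in_ext_at_old,
  in_ext_at_new, old_neq_new, (inj_eq old_inj), eqxx).

Variables (M : matroid 'I_d) (c : 'I_d).

Definition series_bases : {set {set 'I_d.+1}} :=
  [set ext_new B | B in bases M] :|:
  [set ext_at c B | B in [set B in bases M | c \notin B]].

Lemma series_basesP A : reflect
  ((exists2 B, B \in bases M & A = ext_new B) \/
   (exists B, [/\ B \in bases M, c \notin B & A = ext_at c B]))
  (A \in series_bases).
Proof.
rewrite inE; apply: (iffP orP) => -[].
- by case/imsetP=> B ? ->; left; exists B.
- by case/imsetP=> B; rewrite inE => /andP[? ?] ->; right; exists B.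
- by case=> B ? ->; left; apply: imset_f.
- by case=> B [? ? ->]; right; apply: imset_f; rewrite inE; apply/andP.
Qed.

Lemma series_bases_neq0 : series_bases != set0.
Proof.
have /set0Pn[B MB] := bases_neq0 M.
by apply/set0Pn; exists (ext_new B); apply/series_basesP; left; exists B.
Qed.

Lemma series_exchange (A1 A2 : {set 'I_d.+1}) (x : 'I_d.+1) :
  A1 \in series_bases -> A2 \in series_bases -> x \in A1 :\: A2 ->
  exists2 y, y \in A2 :\: A1 & (y |: (A1 :\ x)) \in series_bases.
Proof.
have inN B : B \in bases M -> ext_new B \in series_bases.
  by move=> MB; apply/series_basesP; left; exists B.
have inC B : B \in bases M -> c \notin B -> ext_at c B \in series_bases.
  by move=> MB cB; apply/series_basesP; right; exists B.
have exch B1 B2 e : B1 \in bases M -> B2 \in bases M ->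
    e \in B1 -> e \notin B2 ->
    exists y, [/\ y \in B2, y \notin B1 & (y |: (B1 :\ e)) \in bases M].
  move=> M1 M2 e1 e2; case: (@basis_exchange _ M B1 B2 e) => //.
    by rewrite inE e2.
  by move=> y; rewrite inE => /andP[? ?] ?; exists y.
move=> /series_basesP[[B1 M1 ->]|[B1 [M1 c1 ->]]];
move=> /series_basesP[[B2 M2 ->]|[B2 [M2 c2 ->]]]; rewrite inE;
case: (ordP x) => [e|]; rewrite !extE ?andbF //=.
- case/andP=> e2 e1; have [y [y2 y1 My]] := exch _ _ _ M1 M2 e1 e2.
  exists (old y); first by rewrite inE !extE y1.
  suff -> : old y |: (ext_new B1 :\ old e) = ext_new (y |: (B1 :\ e)).
    exact: inN.
  apply/setP => z; case: (ordP z) => [f|]; rewrite in_setU1 in_setD1 !extE.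
    by rewrite in_setU1 in_setD1.
  by rewrite eq_sym extE (eq_sym new) extE.
- rewrite negb_or => /andP[/andP[ec e2] e1].
  have [y [y2 y1 My]] := exch _ _ _ M1 M2 e1 e2.
  exists (old y); first by rewrite inE !extE y1 y2 orbT.
  suff -> : old y |: (ext_new B1 :\ old e) = ext_new (y |: (B1 :\ e)).
    exact: inN.
  apply/setP => z; case: (ordP z) => [f|]; rewrite in_setU1 in_setD1 !extE.
    by rewrite in_setU1 in_setD1.
  by rewrite eq_sym extE (eq_sym new) extE.
- move=> _; case c1: (c \in B1).
    have [y [y2 y1 My]] := exch _ _ _ M1 M2 c1 c2.
    have yc : (y == c) = false by apply: contraNF c2 => /eqP <-.
    exists (old y); first by rewrite inE !extE y1 y2 orbT.
    suff -> : old y |: (ext_new B1 :\ new) = ext_at c (y |: (B1 :\ c)).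
      by apply: inC => //; rewrite in_setU1 in_setD1 eqxx eq_sym yc.
    apply/setP => z; case: (ordP z) => [f|]; rewrite in_setU1 in_setD1 !extE.
      by rewrite in_setU1 in_setD1; case: eqVneq => // _; case: eqVneq => //= ->.
    by rewrite eq_sym extE.
  exists (old c); first by rewrite inE !extE c1.
  suff -> : old c |: (ext_new B1 :\ new) = ext_at c B1 by apply: inC; rewrite ?c1.
  apply/setP => z; case: (ordP z) => [f|]; rewrite in_setU1 in_setD1 !extE //.
  by rewrite eq_sym extE.
- case/andP=> e2 /orP[/eqP ec|e1].
    rewrite {}ec in e2 *.
    exists new; first by rewrite inE !extE.
    suff -> : new |: (ext_at c B1 :\ old c) = ext_new B1 by apply: inN.
    apply/setP => z; case: (ordP z) => [f|]; rewrite in_setU1 in_setD1 !extE //.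
    by case: eqVneq => //= ->; rewrite (negbTE c1).
  have ec : (e == c) = false by apply: contraNF c1 => /eqP <-.
  have [y [y2 y1 My]] := exch _ _ _ M1 M2 e1 e2.
  case: (eqVneq y c) => [yc|yc].
    rewrite {}yc in y2 y1 My.
    exists new; first by rewrite inE !extE.
    suff -> : new |: (ext_at c B1 :\ old e) = ext_new (c |: (B1 :\ e)).
      exact: inN.
    apply/setP => z; case: (ordP z) => [f|]; rewrite in_setU1 in_setD1 !extE //.
    rewrite in_setU1 in_setD1 /=.
    by case: (eqVneq f e) => //= ->; rewrite ec.
  exists (old y); first by rewrite inE !extE negb_or y1 yc.
  suff -> : old y |: (ext_at c B1 :\ old e) = ext_at c (y |: (B1 :\ e)).
    apply: inC => //.
    by rewrite in_setU1 in_setD1 eq_sym (negbTE yc) (negbTE c1) andbF.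
  apply/setP => z; case: (ordP z) => [f|]; rewrite in_setU1 in_setD1 !extE.
    rewrite in_setU1 in_setD1.
    by case: (eqVneq f e) => //= [->|]; rewrite ?ec ?orbF // orbCA.
  by rewrite eq_sym extE andbF.
- rewrite !negb_or => /andP[/andP[ec e2]]; rewrite (negbTE ec) /= => e1.
  have [y [y2 y1 My]] := exch _ _ _ M1 M2 e1 e2.
  have yc : (y == c) = false by apply: contraNF c2 => /eqP <-.
  exists (old y); first by rewrite inE !extE negb_or y1 yc y2.
  suff -> : old y |: (ext_at c B1 :\ old e) = ext_at c (y |: (B1 :\ e)).
    apply: inC => //.
    by rewrite in_setU1 in_setD1 eq_sym yc (negbTE c1) andbF.
  apply/setP => z; case: (ordP z) => [f|]; rewrite in_setU1 in_setD1 !extE.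
    rewrite in_setU1 in_setD1.
    case: (eqVneq f e) => //= [->|]; first by rewrite (negbTE ec) ?orbF.
    by rewrite orbCA.
  by rewrite eq_sym extE andbF.
Qed.

Definition series_extension : matroid 'I_d.+1 :=
  Matroid series_bases_neq0 series_exchange.

(* The n + gamma variables of the big polynomial ring: index [lshift gamma j]
   stands for x^1_j, i.e. for B_j + (d+1); index [rshift n j] stands for x^2_j,
   i.e. for B_j + c. *)
Variables (n gamma : nat) (hgn : (gamma <= n)%N) (B : numbering M n).
Hypothesis hB : forall j : 'I_n, (c \notin B j) = (j < gamma)%N.

Definition series_basis_of (k : 'I_(n + gamma)) : {set 'I_d.+1} :=
  match split k with
  | inl j => ext_new (B j)
  | inr j => ext_at c (B (widen_ord hgn j))
  end.

Lemma series_basis_of_inj : injective series_basis_of.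
Proof.
move=> k k'; rewrite /series_basis_of => h.
rewrite -(splitK k) -(splitK k').
case: (split k) h => j; case: (split k') => j' /setP h.
- congr unsplit; congr inl; apply: (@basis_of_inj _ _ _ B); apply/setP => e.
  by have := h (old e); rewrite !extE.
- by have := h new; rewrite !extE.
- by have := h new; rewrite !extE.
- have cB (i : 'I_gamma) : c \notin B (widen_ord hgn i) by rewrite hB /=.
  suff E : widen_ord hgn j = widen_ord hgn j'.
    by congr unsplit; congr inr; apply: val_inj; exact: (congr1 val E).
  apply: (@basis_of_inj _ _ _ B); apply/setP => e.
  have := h (old e); rewrite !extE; case: (eqVneq e c) => //= -> _.
  by rewrite !(negbTE (cB _)).
Qed.

Lemma series_basis_of_codom :
  [set series_basis_of k | k : 'I_(n + gamma)] = bases series_extension.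
Proof.
apply/setP => A; apply/imsetP/series_basesP.
- case=> k _ ->; rewrite /series_basis_of; case: (split k) => j.
    by left; exists (B j); rewrite // -(basis_of_codom B) imset_f.
  right; exists (B (widen_ord hgn j)); split => //.
    by rewrite -(basis_of_codom B) imset_f.
  by rewrite hB /=.
- case=> [[C]|[C []]]; rewrite -(basis_of_codom B) => /imsetP[j _ ->].
    move=> ->; exists (lshift gamma j) => //.
    by rewrite /series_basis_of (unsplitK (inl j)).
  rewrite hB => jg ->; exists (rshift n (Ordinal jg)) => //.
  rewrite /series_basis_of (unsplitK (inr _)); congr (ext_at c (B _)).
  exact: val_inj.
Qed.

Definition series_numbering : numbering series_extension (n + gamma) :=
  Numbering series_basis_of_inj series_basis_of_codom.

End SeriesExtension.

Definition ideal_gen (R : comNzRingType) (S : R -> Prop) (p : R) : Prop :=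
  exists (k : nat) (q s : 'I_k -> R),
    (forall i, S (s i)) /\ p = \sum_(i < k) q i * s i.

Definition generates (R : comNzRingType) (J S : R -> Prop) : Prop :=
  forall p, J p <-> ideal_gen S p.

Section Toric.
Variables (K : fieldType) (d : nat) (N : matroid 'I_d) (m : nat).
Variable C : numbering N m.

Definition toric_map (p : {mpoly K[m]}) : {mpoly K[d]} :=
  mmap (@mpolyC d K) (fun j => \prod_(e in C j) 'X_e) p.

Definition toric_ideal (p : {mpoly K[m]}) : Prop := toric_map p = 0.

End Toric.

Section Groebner.
Variables (K : fieldType) (n : nat).
Implicit Types (le : rel 'X_{1..n}) (J G : {mpoly K[n]} -> Prop).

Definition monomial_order le : Prop :=
  [/\ reflexive le, antisymmetric le, transitive le & total le] /\
  (forall a, le 0%MM a) /\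
  (forall a b e, le a b -> le (a + e)%MM (b + e)%MM).

(* In particular [f] is nonzero. *)
Definition leading_monomial le (f : {mpoly K[n]}) (a : 'X_{1..n}) : Prop :=
  a \in msupp f /\ {in msupp f, forall b, le b a}.

Definition initial_monomials le G (p : {mpoly K[n]}) : Prop :=
  exists f a, [/\ G f, leading_monomial le f a & p = 'X_[a]].

Definition initial_ideal le J : {mpoly K[n]} -> Prop :=
  ideal_gen (initial_monomials le J).

Definition finite_family G : Prop :=
  exists s : seq {mpoly K[n]}, forall f, G f -> f \in s.

Definition groebner_basis le J G : Prop :=
  [/\ finite_family G, (forall f, G f -> J f) &
      generates (initial_ideal le J) (initial_monomials le G)].

Definition homogeneous_binomial (f : {mpoly K[n]}) : Prop :=
  exists a b : 'X_{1..n},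
    [/\ a != b, mdeg a = mdeg b & f = 'X_[a] - 'X_[b]].

End Groebner.

(* The ordered factors j_1, ..., j_u / k_1, ..., k_v of the first monomial
   and j'_1, ..., j'_u' / k'_1, ..., k'_v' of the second monomial. *)
Record listing (n gamma : nat) := Listing {
  lj : seq 'I_gamma; lk : seq 'I_n;
  lj' : seq 'I_gamma; lk' : seq 'I_n
}.

Section Lift.
Variables (K : fieldType) (n gamma : nat) (hgn : (gamma <= n)%N).

Definition listing_of (f : {mpoly K[n]}) (L : listing n gamma) : Prop :=
  [/\ {in lk L, forall k : 'I_n, (gamma <= k)%N},
      {in lk' L, forall k : 'I_n, (gamma <= k)%N} &
      f = \prod_(j <- lj L) 'X_(widen_ord hgn j) * \prod_(k <- lk L) 'X_k
        - \prod_(j <- lj' L) 'X_(widen_ord hgn j) * \prod_(k <- lk' L) 'X_k].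

Definition x1 (j : 'I_n) : {mpoly K[n + gamma]} := 'X_(lshift gamma j).
Definition x2 (j : 'I_gamma) : {mpoly K[n + gamma]} := 'X_(rshift n j).

(* x^i_j for j in [gamma]; the superscript 1 is [false] and 2 is [true]. *)
Definition x12 (i : bool) (j : 'I_gamma) : {mpoly K[n + gamma]} :=
  if i then x2 j else x1 (widen_ord hgn j).

(* f^I. For a homogeneous f in J_M the lists [lj L], [lj' L] and [I] all have
   the same length, so that [zip] does not drop any factor. *)
Definition lift_binomial (L : listing n gamma) (I : seq bool) :
    {mpoly K[n + gamma]} :=
  \prod_(p <- zip I (lj L)) x12 p.1 p.2 * \prod_(k <- lk L) x1 k
  - \prod_(p <- zip I (lj' L)) x12 p.1 p.2 * \prod_(k <- lk' L) x1 k.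

Definition lifted_family (F : {mpoly K[n]} -> Prop)
    (L : {mpoly K[n]} -> listing n gamma) (g : {mpoly K[n + gamma]}) : Prop :=
  (exists f (I : seq bool),
     [/\ F f, size I = size (lj (L f)) & g = lift_binomial (L f) I]) \/
  (exists j1 j2 : 'I_gamma, (j1 < j2)%N /\
     g = x1 (widen_ord hgn j2) * x2 j1 - x1 (widen_ord hgn j1) * x2 j2).

End Lift.

(* Main.v *)
(* Erasing superscripts sends a monomial of the big ring to one of
   K[x_1, ..., x_n]. All bases of the series extension have the same positive
   cardinality, so two monomials of the big ring have the same toric image iff
   they have the same degree, the same degree in the x^2, and their erasures
   have the same toric image. Modulo the quadrics, the monomials with given
   erasure and given degree in the x^2 are all congruent, and every relation
   w * f with f in F lifts to monomial multiples of the f^I; so lifting to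
   x^2-degree q is a well defined linear map from K[x_1, ..., x_n] modulo (F)
   to the big ring modulo the lifted family, and its vanishing on J_M gives the
   generators.
   For Groebner bases, compare erasures first and break ties by the order of
   the x^2-parts. A leading monomial m of J_(M+) that is not the least one with
   its erasure and x^2-degree q is divisible by the leading monomial of a
   quadric. Otherwise erasing superscripts in the part of x^2-degree q of the
   polynomial does not cancel m and yields an element of J_M led by the erasure
   of m; a leading monomial of F dividing it lifts to a divisor of m. *)
Require Import Defs.
From HB Require Import structures.
From mathcomp Require Import all_boot all_order all_algebra.
From mathcomp Require Import mpoly ssrcomplements bigenough.

Set Implicit Arguments.
Unset Strict Implicit.
Unset Printing Implicit Defensive.

Import BigEnough Order.TTheory GRing.Theory.
Local Open Scope ring_scope.

(** * Ideals and linear extension from monomials *)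

Section IdealGen.
Variables (R : comNzRingType) (S : R -> Prop).

Lemma ideal_genM a p : S p -> ideal_gen S (a * p).
Proof. by exists 1, (fun=> a), (fun=> p); rewrite big_ord1. Qed.

Lemma ideal_gen_mem p : S p -> ideal_gen S p.
Proof. by move=> Sp; rewrite -[p]mul1r; apply: ideal_genM. Qed.

Lemma ideal_gen0 : ideal_gen S 0.
Proof. by exists 0, (fun=> 0), (fun=> 0); split=> [[]|]; rewrite ?big_ord0. Qed.

Lemma ideal_genD p q : ideal_gen S p -> ideal_gen S q -> ideal_gen S (p + q).
Proof.
case=> k [a [s [Ss ->]]] [l [b [t [St ->]]]].
pose glue (T : Type) (f : 'I_k -> T) (g : 'I_l -> T) i :=
  match split i with inl i => f i | inr i => g i end.
exists (k + l), (glue _ a b), (glue _ s t); split=> [i|].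
  by rewrite /glue; case: split.
rewrite big_split_ord /glue /=.
congr (_ + _); apply: eq_bigr => i _.
  by rewrite (unsplitK (inl i)).
by rewrite (unsplitK (inr i)).
Qed.

Lemma ideal_genMl a p : ideal_gen S p -> ideal_gen S (a * p).
Proof.
case=> k [q [s [Ss ->]]]; exists k, (fun i => a * q i), s; split=> //.
by rewrite mulr_sumr; apply: eq_bigr => i _; rewrite mulrA.
Qed.

Lemma ideal_genN p : ideal_gen S p -> ideal_gen S (- p).
Proof. by move=> Sp; rewrite -mulN1r; apply: ideal_genMl. Qed.

Lemma ideal_genB p q : ideal_gen S p -> ideal_gen S q -> ideal_gen S (p - q).
Proof. by move=> Sp Sq; apply/ideal_genD/ideal_genN. Qed.

Lemma ideal_gen_sum (T : eqType) (r : seq T) (F : T -> R) :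
  (forall i, i \in r -> ideal_gen S (F i)) -> ideal_gen S (\sum_(i <- r) F i).
Proof.
rewrite big_seq => SF; apply: (big_ind (ideal_gen S)) SF.
  exact: ideal_gen0.
exact: ideal_genD.
Qed.

Lemma sub_ideal_gen (S' : R -> Prop) p :
  (forall s, S' s -> ideal_gen S s) -> ideal_gen S' p -> ideal_gen S p.
Proof.
move=> S'S [k [q [s [S's ->]]]].
by apply: ideal_gen_sum => i _; apply/ideal_genMl/S'S.
Qed.

End IdealGen.

Section MonomialExtension.
Variables (K : comNzRingType) (n : nat) (V : lmodType K) (g : 'X_{1..n} -> V).

(** Linear, but with no multiplicativity asked of [g]: lifting to a fixed degree in the x^2 and
    slicing by that degree are extended from monomials in this way. *)
Definition monext (p : {mpoly K[n]}) : V := \sum_(a <- msupp p) p@_a *: g a.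

Lemma monextwE k p :
  (msize p <= k)%N -> monext p = \sum_(a : 'X_{1..n < k}) p@_a *: g a.
Proof.
move=> lt_pk; pose I : subFinType _ := 'X_{1..n < k}.
rewrite /monext (big_mksub I) /= ?msupp_uniq //.
  by rewrite big_rmcond //= => i; move/memN_msupp_eq0 ->; rewrite scale0r.
by move=> x /msize_mdeg_lt /leq_trans; apply.
Qed.

Lemma monext_is_linear : linear monext.
Proof.
move=> c p q; pose_big_enough j; first rewrite !(@monextwE j) //.
  rewrite scaler_sumr -big_split /=; apply: eq_bigr => k _.
  by rewrite scalerA -scalerDl mcoeffD mcoeffZ.
by close.
Qed.

HB.instance Definition _ :=
  GRing.isLinear.Build K {mpoly K[n]} V _ monext monext_is_linear.

Lemma monextX a : monext 'X_[a] = g a.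
Proof. by rewrite /monext msuppX big_seq1 mcoeffX eqxx scale1r. Qed.

End MonomialExtension.

Lemma monext_comp (K : comNzRingType) m n (V : lmodType K)
    (h : 'X_{1..m} -> 'X_{1..n}) (g : 'X_{1..n} -> V) (p : {mpoly K[m]}) :
  monext g (monext (fun a => 'X_[h a]) p) = monext (g \o h) p.
Proof.
rewrite {2}/monext linear_sum; apply: eq_bigr => a _.
by rewrite linearZ /= monextX.
Qed.

Section Binomials.
Variables (K : fieldType) (n : nat).
Implicit Types (a b : 'X_{1..n}) (p : {mpoly K[n]}).

Lemma mcoeff_binom a b e :
  ('X_[a] - 'X_[b] : {mpoly K[n]})@_e = (a == e)%:R - (b == e)%:R.
Proof. by rewrite mcoeffB !mcoeffX. Qed.

Lemma mem_msupp_binom a b e : a != b ->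
  (e \in msupp ('X_[a] - 'X_[b] : {mpoly K[n]})) = (e == a) || (e == b).
Proof.
move=> ab; rewrite mcoeff_msupp mcoeff_binom (eq_sym e a) (eq_sym e b).
have [<-|_] := eqVneq a e.
  by rewrite (eq_sym b) (negbTE ab) subr0 oner_eq0.
by have [_|_] := eqVneq b e; rewrite ?subrr ?sub0r ?oppr_eq0 ?oner_eq0 ?eqxx.
Qed.

Lemma mpolyX_inj : injective (fun a : 'X_{1..n} => 'X_[a] : {mpoly K[n]}).
Proof.
by move=> a b /(congr1 (@msupp _ _)); rewrite !msuppX => -[].
Qed.

(** Some summand has a nonzero coefficient at [w], and every monomial in a multiple of ['X_[a]] is
    divisible by it. *)
Lemma ideal_gen_monomial_dvd (S : {mpoly K[n]} -> Prop) w :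
  (forall s, S s -> exists a, s = 'X_[a]) -> ideal_gen S 'X_[w] ->
  exists2 a, S 'X_[a] & (a <= w)%MM.
Proof.
move=> Smon [k [q [s [Ss /(congr1 (mcoeff w)) /esym/eqP]]]].
rewrite mcoeffX eqxx raddf_sum => ws.
have [i wsi]: exists i, (q i * s i)@_w != 0.
  apply/existsP; apply: contraTT ws; rewrite negb_exists => /forallP ws0.
  by rewrite big1 ?[0 == _]eq_sym ?oner_eq0 // => i _; apply/eqP/negPn/ws0.
have [a sia] := Smon _ (Ss i); exists a; first by rewrite -sia.
move: wsi; rewrite sia -mcoeff_msupp (perm_mem (msuppMX _ _)).
by case/mapP=> b _ ->; apply: lem_addr.
Qed.

End Binomials.

(** * Toric ideals *)

(** Induction on the size of [B1 :\: B2]: an exchange keeps the size of [B1] and shrinks this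
    difference. *)
Lemma card_basis_le (T : finType) (M : matroid T) (B1 B2 : {set T}) :
  B1 \in bases M -> B2 \in bases M -> (#|B1| <= #|B2|)%N.
Proof.
move: {2}#|B1 :\: B2| (leqnn #|B1 :\: B2|) => k.
elim: k B1 => [|k IHk] B1 leB1k MB1 MB2.
  by apply: subset_leq_card; rewrite -setD_eq0 -cards_eq0 -leqn0.
have [/eqP|/set0Pn[x xB]] := eqVneq (B1 :\: B2) set0.
  by rewrite setD_eq0 => /subset_leq_card.
have [y /setDP[yB2 yB1] MB] := basis_exchange MB1 MB2 xB.
have /setDP[xB1 xB2] := xB.
have <- : #|y |: (B1 :\ x)| = #|B1|.
  by rewrite cardsU1 !inE (negbTE yB1) andbF (cardsD1 x B1) xB1.
apply: IHk MB MB2; rewrite -ltnS; apply: leq_trans leB1k.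
rewrite (cardsD1 x (B1 :\: B2)) xB ltnS; apply: subset_leq_card.
apply/subsetP=> z; rewrite !inE => /andP[zB2 /orP[/eqP zy|/andP[-> ->]]].
  by rewrite zy yB2 in zB2.
by rewrite zB2.
Qed.

Lemma card_basis (T : finType) (M : matroid T) (B1 B2 : {set T}) :
  B1 \in bases M -> B2 \in bases M -> #|B1| = #|B2|.
Proof.
by move=> M1 M2; apply/eqP; rewrite eqn_leq !(card_basis_le (M := M)).
Qed.

(** * Exponents of toric images *)

Section ToricExponent.
Variables (d m : nat) (C : 'I_m -> {set 'I_d}).
Implicit Types a b : 'X_{1..m}.

Definition toric_mnm a : 'X_{1..d} :=
  [multinom (\sum_(j < m) a j * (e \in C j))%N | e < d].

Lemma toric_mnmE a e : toric_mnm a e = (\sum_(j < m) a j * (e \in C j))%N.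
Proof. by rewrite mnmE. Qed.

Lemma mdeg_toric_mnm r a :
  (forall j, #|C j| = r) -> mdeg (toric_mnm a) = (mdeg a * r)%N.
Proof.
move=> Cr; rewrite !mdegE big_distrl /=.
under eq_bigr do rewrite toric_mnmE.
rewrite exchange_big; apply: eq_bigr => j _.
by rewrite -big_distrr /= -(Cr j) -sum1_card [in RHS]big_mkcond.
Qed.

End ToricExponent.

Section ToricIdeal.
Variables (K : fieldType) (d : nat) (N : matroid 'I_d) (m : nat).
Variable C : numbering N m.
Implicit Types (a b : 'X_{1..m}) (p q : {mpoly K[m]}).

Lemma toric_mapE p :
  toric_map C p = monext (fun a => 'X_[toric_mnm C a] : {mpoly K[d]}) p.
Proof.
rewrite /toric_map /mmap /monext; apply: eq_bigr => a _.
rewrite mul_mpolyC; congr (_ *: _); rewrite /mmap1.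
under eq_bigr do rewrite mprodXE mpolyXn.
rewrite mprodXE; congr 'X_[_]; apply/mnmP => e.
rewrite mnm_sumE toric_mnmE; apply: eq_bigr => j _.
rewrite mulmnE mnm_sumE mulnC; congr (_ * _)%N.
under eq_bigr do rewrite mnm1E.
case: (boolP (e \in C j)) => [ej|/negP ej].
  rewrite (bigD1 e) //= eqxx big1 // => i /andP[_ /negbTE ie].
  by rewrite ie.
by rewrite big1 // => i ij; case: eqP => // ie; rewrite ie in ij.
Qed.

Lemma toric_ideal_binomial a b :
  toric_mnm C a = toric_mnm C b <->
  toric_ideal C ('X_[a] - 'X_[b] : {mpoly K[m]}).
Proof.
rewrite /toric_ideal toric_mapE linearB /= !monextX.
split=> [->|/eqP]; first by rewrite subrr.
by rewrite subr_eq0 => /eqP /mpolyX_inj.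
Qed.

Lemma toric_idealD p q :
  toric_ideal C p -> toric_ideal C q -> toric_ideal C (p + q).
Proof.
by rewrite /toric_ideal !toric_mapE linearD /= => -> ->; rewrite addr0.
Qed.

Lemma toric_idealM p q : toric_ideal C q -> toric_ideal C (p * q).
Proof.
by rewrite /toric_ideal /toric_map rmorphM /= => ->; rewrite mulr0.
Qed.

Lemma ideal_gen_sub_toric (S : {mpoly K[m]} -> Prop) p :
  (forall s, S s -> toric_ideal C s) -> ideal_gen S p -> toric_ideal C p.
Proof.
move=> SJ [k [q [s [Ss ->]]]]; apply: (big_ind (toric_ideal C)).
- by rewrite /toric_ideal toric_mapE linear0.
- exact: toric_idealD.
- by move=> i _; apply/toric_idealM/SJ.
Qed.

(* Composing [toric_map] with a section of it on the monomials of [p] gives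
   a polynomial that is both zero and congruent to [p]. *)
Lemma toric_ideal_span p : toric_ideal C p ->
  exists2 rep : 'X_{1..m} -> 'X_{1..m},
    {in msupp p, forall a, toric_mnm C (rep a) = toric_mnm C a} &
    p = \sum_(a <- msupp p) p@_a *: ('X_[a] - 'X_[rep a]).
Proof.
(* The first monomial of [p] with toric image [w]; on images of monomials of [p] the default is
   never reached. *)
pose sec (w : 'X_{1..d}) :=
  nth 0%MM (msupp p) (find (fun a => toric_mnm C a == w) (msupp p)).
rewrite /toric_ideal toric_mapE => Jp; exists (sec \o toric_mnm C).
  move=> a pa; apply/eqP/(nth_find 0%MM (a := fun b => toric_mnm C b == _)).
  by apply/hasP; exists a.
under eq_bigr do rewrite scalerBr.
rewrite sumrB -mpolyE -[LHS]subr0; congr (_ - _).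
by rewrite -[RHS](monext_comp _ (fun w => 'X_[sec w])) Jp linear0.
Qed.

End ToricIdeal.

(** * Erasing superscripts *)

Section Superscripts.
Variables (n gamma : nat) (hgn : (gamma <= n)%N).
Implicit Types (a b : 'X_{1..(n + gamma)}) (i : 'I_gamma) (j k : 'I_n).

Definition part1 a : 'X_{1..n} := [multinom a (lshift gamma j) | j < n].
Definition part2 a : 'X_{1..gamma} := [multinom a (rshift n i) | i < gamma].
Definition widen_mnm (w : 'X_{1..gamma}) : 'X_{1..n} :=
  [multinom (\sum_(i < gamma | widen_ord hgn i == j) w i)%N | j < n].

(* The exponent in K[x_1, ..., x_n] obtained by erasing the superscripts. *)
Definition forget a : 'X_{1..n} := (part1 a + widen_mnm (part2 a))%MM.

Lemma part1D a b : part1 (a + b)%MM = (part1 a + part1 b)%MM.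
Proof. by apply/mnmP=> j; rewrite mnmDE !mnmE. Qed.

Lemma part2D a b : part2 (a + b)%MM = (part2 a + part2 b)%MM.
Proof. by apply/mnmP=> j; rewrite mnmDE !mnmE. Qed.

Lemma widen_mnmD v w : widen_mnm (v + w)%MM = (widen_mnm v + widen_mnm w)%MM.
Proof.
apply/mnmP=> j; rewrite mnmDE !mnmE -big_split /=.
by apply: eq_bigr => i _; rewrite mnmDE.
Qed.

Lemma forgetD a b : forget (a + b)%MM = (forget a + forget b)%MM.
Proof. by rewrite /forget part1D part2D widen_mnmD Monoid.mulmACA. Qed.

Lemma widen_mnm0 : widen_mnm 0%MM = 0%MM.
Proof.
by apply/mnmP=> j; rewrite mnmE big1 ?mnm0E // => i _; rewrite mnm0E.
Qed.

Lemma part2_0 : part2 0%MM = 0%MM.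
Proof. by apply/mnmP=> j; rewrite mnmE !mnm0E. Qed.

Lemma forget0 : forget 0%MM = 0%MM.
Proof.
rewrite /forget part2_0 widen_mnm0 addm0.
by apply/mnmP=> j; rewrite mnmE !mnm0E.
Qed.

Lemma part2_lshift j : part2 U_(lshift gamma j)%MM = 0%MM.
Proof. by apply/mnmP=> i; rewrite mnmE mnm1E eq_lrshift mnm0E. Qed.

Lemma part2_rshift i : part2 U_(rshift n i)%MM = U_(i)%MM.
Proof. by apply/mnmP=> j; rewrite mnmE !mnm1E (inj_eq (@rshift_inj _ _)). Qed.

Lemma forget_lshift j : forget U_(lshift gamma j)%MM = U_(j)%MM.
Proof.
rewrite /forget part2_lshift widen_mnm0 addm0.
by apply/mnmP=> k; rewrite mnmE !mnm1E (inj_eq (@lshift_inj _ _)).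
Qed.

Lemma forget_rshift i : forget U_(rshift n i)%MM = U_(widen_ord hgn i)%MM.
Proof.
rewrite /forget part2_rshift; apply/mnmP=> k; rewrite mnmDE !mnmE eq_rlshift.
rewrite big_mkcond (bigD1 i) //= mnm1E eqxx big1 ?addn0 => [|j /negbTE ji].
  by case: eqP.
by rewrite mnm1E (eq_sym i) ji if_same.
Qed.

Lemma forget_widen a i :
  forget a (widen_ord hgn i) =
  (a (lshift gamma (widen_ord hgn i)) + a (rshift n i))%N.
Proof.
have widenI: injective (widen_ord hgn).
  by move=> x y /(congr1 val) /= ?; apply: val_inj.
rewrite mnmDE !mnmE; under eq_bigl do rewrite (inj_eq widenI).
by rewrite big_pred1_eq mnmE.
Qed.

Lemma forget_ge a k : (gamma <= k)%N -> forget a k = a (lshift gamma k).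
Proof.
move=> gk; rewrite mnmDE !mnmE big1 ?addn0 // => i /eqP ik.
by move: gk; rewrite -ik leqNgt /= ltn_ord.
Qed.

(** The x^1-part is recovered from the erasure by cancelling the widened x^2-part. *)
Lemma forget_part2_inj a b :
  forget a = forget b -> part2 a = part2 b -> a = b.
Proof.
move=> + ab2; rewrite /forget ab2 => /addIm ab1; apply/mnmP=> i.
case: (split_ordP i) => j ->; first by have /mnmP/(_ j) := ab1; rewrite !mnmE.
by have /mnmP/(_ j) := ab2; rewrite !mnmE.
Qed.

Lemma widen_mnm_sum (w : 'X_{1..gamma}) (f : 'I_n -> nat) :
  (\sum_j widen_mnm w j * f j = \sum_i w i * f (widen_ord hgn i))%N.
Proof.
under eq_bigr do rewrite mnmE big_distrl.
rewrite (exchange_big_dep xpredT) //=; apply: eq_bigr => i _.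
by under eq_bigl do rewrite eq_sym; rewrite big_pred1_eq.
Qed.

Lemma mdeg_forget a : mdeg (forget a) = mdeg a.
Proof.
rewrite !mdegE big_split_ord /=; under eq_bigr do rewrite mnmDE mnmE.
rewrite big_split; congr (_ + _)%N.
transitivity (\sum_j widen_mnm (part2 a) j * 1)%N.
  by apply: eq_bigr => j _; rewrite muln1.
by rewrite widen_mnm_sum; apply: eq_bigr => i _; rewrite muln1 mnmE.
Qed.

Lemma mdeg_parts a : mdeg a = (mdeg (part1 a) + mdeg (part2 a))%N.
Proof.
rewrite !mdegE big_split_ord /=.
by congr (_ + _)%N; apply: eq_bigr => i _; rewrite mnmE.
Qed.

End Superscripts.

(** * The toric ideal of the series extension *)

Section SeriesToric.
Variables (d : nat) (M : matroid 'I_d) (c : 'I_d).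
Variables (n gamma : nat) (hgn : (gamma <= n)%N) (B : numbering M n).
Hypothesis hB : forall j : 'I_n, (c \notin B j) = (j < gamma)%N.
Implicit Types a b : 'X_{1..(n + gamma)}.

Local Notation B' := (series_basis_of c hgn B).

(** The basis attached to x^2_j is B_j with the extra element [c], so the exponent of [c] also
    counts the degree in the x^2. *)
Lemma series_toric_old a e :
  toric_mnm B' a (old e) =
  (toric_mnm B (forget hgn a) e + (e == c) * mdeg (part2 a))%N.
Proof.
rewrite !toric_mnmE big_split_ord /=.
under [in RHS]eq_bigr do rewrite mnmDE mulnDl mnmE.
rewrite big_split /= (widen_mnm_sum _ _ (fun j => (e \in B j) : nat)) -addnA.
congr (_ + _)%N.
  by apply: eq_bigr => j _; rewrite /series_basis_of (unsplitK (inl j)) !extE.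
rewrite mdegE big_distrr -big_split /=; apply: eq_bigr => i _.
rewrite /series_basis_of (unsplitK (inr i)) !extE mnmE.
have: c \notin B (widen_ord hgn i) by rewrite hB /=.
case: eqVneq => [->|_] ci /=; last by rewrite mul0n addn0.
by rewrite (negbTE ci) muln1 muln0 mul1n.
Qed.

(** The new element lies in exactly the bases attached to the x^1. *)
Lemma series_toric_new a : toric_mnm B' a (Defs.new d) = mdeg (part1 a).
Proof.
rewrite toric_mnmE big_split_ord /= mdegE [X in (_ + X)%N]big1 => [|i _].
  rewrite addn0; apply: eq_bigr => j _.
  by rewrite /series_basis_of (unsplitK (inl j)) !extE muln1 mnmE.
by rewrite /series_basis_of (unsplitK (inr i)) !extE muln0.
Qed.

(* Degrees are recovered from the toric image because all bases of the series
   extension have the same, positive, cardinality. *)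
Lemma series_toric_eqP a b :
  toric_mnm (series_numbering hgn hB) a = toric_mnm (series_numbering hgn hB) b
  <-> [/\ mdeg (part2 a) = mdeg (part2 b), mdeg a = mdeg b &
          toric_mnm B (forget hgn a) = toric_mnm B (forget hgn b)].
Proof.
split=> [ab|[ab2 dab ab]]; last first.
  apply/mnmP=> e; case: (ordP e) => [f|].
    by rewrite !series_toric_old ab2 ab.
  rewrite !series_toric_new; apply/eqP; rewrite -(eqn_add2r (mdeg (part2 a))).
  by rewrite -mdeg_parts ab2 -mdeg_parts dab.
have dab: mdeg a = mdeg b.
  have [m0 _|k0] := pickP (@predT 'I_(n + gamma)); last first.
    rewrite !mdegE !big1 // => k; first by have := k0 k.
    by have := k0 k.
  have B'M k : B' k \in bases (series_extension M c).
    by rewrite -(basis_of_codom (series_numbering hgn hB)) imset_f.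
  have cB k : #|B' k| = #|B' m0| by apply: card_basis (B'M k) (B'M m0).
  have := mdeg_toric_mnm a cB; rewrite [toric_mnm _ a]ab (mdeg_toric_mnm b cB).
  (* Cardinality zero would make a basis empty, but each one contains the new element or [c]. *)
  move/eqP; rewrite eqn_mul2r cards_eq0 => /orP[/eqP B0|/eqP->//].
  have := B'M m0; rewrite B0 => /series_basesP[[A _]|[A [_ _]]] /setP.
    by move=> /(_ (Defs.new d)); rewrite !extE inE.
  by move=> /(_ (old c)); rewrite !extE inE.
have ab1: mdeg (part1 a) = mdeg (part1 b).
  by rewrite -!series_toric_new; move/mnmP: ab; apply.
have ab2: mdeg (part2 a) = mdeg (part2 b).
  by apply/eqP; rewrite -(eqn_add2l (mdeg (part1 a))) {2}ab1 -!mdeg_parts dab.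
split=> //; apply/mnmP=> e; move/mnmP/(_ (old e)): ab.
by rewrite !series_toric_old ab2 => /addIn.
Qed.

End SeriesToric.

(** * Lifted binomials *)

Section ListMonomials.
Variables (n gamma : nat) (hgn : (gamma <= n)%N).
Implicit Types (s : seq 'I_gamma) (t : seq 'I_n) (I : seq bool).

Definition lift_var (i : bool) (j : 'I_gamma) : 'I_(n + gamma) :=
  if i then rshift n j else lshift gamma (widen_ord hgn j).

Definition list_mnm s t : 'X_{1..n} :=
  (\sum_(j <- s) U_(widen_ord hgn j) + \sum_(k <- t) U_(k))%MM.

Definition lift_mnm I s t : 'X_{1..(n + gamma)} :=
  (\sum_(p <- zip I s) U_(lift_var p.1 p.2)
   + \sum_(k <- t) U_(lshift gamma k))%MM.

Lemma list_mnm_cons j s t :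
  list_mnm (j :: s) t = (U_(widen_ord hgn j) + list_mnm s t)%MM.
Proof. by rewrite /list_mnm big_cons addmA. Qed.

Lemma lift_mnm_cons i I j s t :
  lift_mnm (i :: I) (j :: s) t = (U_(lift_var i j) + lift_mnm I s t)%MM.
Proof. by rewrite /lift_mnm /= big_cons addmA. Qed.

Lemma mdeg_list_mnm s t : mdeg (list_mnm s t) = (size s + size t)%N.
Proof.
rewrite mdegD !mdeg_sum; under eq_bigr do rewrite mdeg1.
by under [X in (_ + X)%N]eq_bigr do rewrite mdeg1; rewrite !sum1_size.
Qed.

Lemma forget_lift_var i j :
  forget hgn U_(lift_var i j)%MM = U_(widen_ord hgn j)%MM.
Proof. by case: i; rewrite /lift_var ?forget_rshift ?forget_lshift. Qed.

Lemma forget_lift_mnm I s t :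
  size I = size s -> forget hgn (lift_mnm I s t) = list_mnm s t.
Proof.
elim: s I => [|j s IHs] [|i I] //= => [_|[/IHs IH]]; last first.
  by rewrite list_mnm_cons lift_mnm_cons forgetD IH forget_lift_var.
rewrite /lift_mnm /list_mnm !big_nil !add0m.
elim: t => [|k t IHt]; first by rewrite !big_nil forget0.
by rewrite !big_cons forgetD IHt forget_lshift.
Qed.

(** The count depends on [I] alone, so the two monomials of a lifted binomial have the same degree
    in the x^2. *)
Lemma mdeg_part2_lift_mnm I s t :
  size I = size s -> mdeg (part2 (lift_mnm I s t)) = count id I.
Proof.
elim: s I => [|j s IHs] [|i I] //= => [_|[/IHs IH]]; last first.
  rewrite lift_mnm_cons part2D mdegD IH; congr (_ + _)%N.
  by case: i; rewrite /lift_var ?part2_rshift ?mdeg1 ?part2_lshift ?mdeg0.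
rewrite /lift_mnm big_nil add0m.
elim: t => [|k t IHt]; first by rewrite !big_nil part2_0 mdeg0.
by rewrite !big_cons part2D part2_lshift add0m.
Qed.

(** Superscripts are chosen one factor at a time: for the first [j] in [s], x^1_j or x^2_j divides
    [c], and the rest is lifted below the quotient. Factors in [t] exist only with superscript 1. *)
Lemma lift_mnm_dvd s t (c : 'X_{1..(n + gamma)}) :
  {in t, forall k : 'I_n, (gamma <= k)%N} ->
  (list_mnm s t <= forget hgn c)%MM ->
  exists2 I, size I = size s & (lift_mnm I s t <= c)%MM.
Proof.
move=> tge; elim: s c => [|j s IHs] c stc.
  exists [::] => //; rewrite /lift_mnm big_nil add0m; apply/mnm_lepP=> i.
  rewrite mnm_sumE; case: (split_ordP i) => k ->.
    have [gk|kg] := leqP gamma k.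
      move/mnm_lepP/(_ k): stc.
      rewrite /list_mnm big_nil add0m mnm_sumE forget_ge //.
      apply: leq_trans; apply: leq_sum => j _.
      by rewrite !mnm1E (inj_eq (@lshift_inj _ _)).
    rewrite big_seq big1 // => j /tge gj; rewrite mnm1E.
    rewrite (inj_eq (@lshift_inj _ _)); case: eqP => // jk.
    by rewrite leqNgt jk kg in gj.
  by rewrite big1 // => j _; rewrite mnm1E eq_lrshift.
have [i ic]: exists i, (U_(lift_var i j) <= c)%MM.
  move/mnm_lepP/(_ (widen_ord hgn j)): stc.
  rewrite list_mnm_cons mnmDE mnm1E eqxx forget_widen.
  case: (posnP (c (rshift n j))) => [->|c2 _].
    rewrite addn0 => c1; exists false; rewrite lep1mP -lt0n.
    exact: leq_trans c1.
  by exists true; rewrite lep1mP -lt0n.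
have Ec := submK ic; move: (c - _)%MM Ec => c' Ec.
case: (IHs c') => [|I sI Ic'].
  apply/mnm_lepP=> k; move/mnm_lepP/(_ k): stc.
  rewrite list_mnm_cons -Ec forgetD forget_lift_var !mnmDE.
  by rewrite [leqRHS]addnC leq_add2l.
exists (i :: I); rewrite /= ?sI // lift_mnm_cons.
move: (lift_mnm I s t) Ic' => v /mnm_lepP vc'; apply/mnm_lepP=> k.
by rewrite -Ec !mnmDE [leqRHS]addnC leq_add2l.
Qed.

(** Exactly the sets with index at least [gamma] contain [c], so its exponent counts the factors in
    [t]. *)
Lemma toric_list_mnm d (C : 'I_n -> {set 'I_d}) c s t :
  (forall j, (c \notin C j) = (j < gamma)%N) ->
  {in t, forall k : 'I_n, (gamma <= k)%N} ->
  toric_mnm C (list_mnm s t) c = size t.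
Proof.
move=> Cc tge; rewrite toric_mnmE.
under eq_bigr do rewrite /list_mnm mnmDE !mnm_sumE mulnDl !big_distrl.
rewrite big_split /= exchange_big [X in (X + _)%N]big1 => [|j _] /=.
  rewrite add0n exchange_big -sum1_size big_seq [in RHS]big_seq /=.
  apply: eq_bigr => k /tge gk.
  rewrite (bigD1 k) //= big1 ?addn0 => [|j /negbTE jk].
    by rewrite mnm1E eqxx mul1n -[_ \in _]negbK Cc -leqNgt gk.
  by rewrite mnm1E eq_sym jk.
rewrite big1 // => k _; rewrite mnm1E; case: eqP => [<-|//].
by rewrite (_ : c \in _ = false) ?muln0 //; apply/negbTE; rewrite Cc /=.
Qed.

End ListMonomials.

(** * The lifted family inside the toric ideal *)

Section LiftedFamily.
Variables (K : fieldType) (d : nat) (M : matroid 'I_d) (c : 'I_d).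
Variables (n gamma : nat) (hgn : (gamma <= n)%N) (B : numbering M n).
Hypothesis hB : forall j : 'I_n, (c \notin B j) = (j < gamma)%N.
Variable F : {mpoly K[n]} -> Prop.
Hypothesis hF : forall f, F f -> homogeneous_binomial f.
Variable L : {mpoly K[n]} -> listing n gamma.
Hypothesis hL : forall f, F f -> listing_of hgn f (L f).
Hypothesis FJ : forall f, F f -> toric_ideal B f.

Local Notation BS := (series_numbering hgn hB).
Local Notation FS := (lifted_family hgn F L).

Lemma x12E i j : x12 K hgn i j = 'X_(lift_var hgn i j).
Proof. by case: i. Qed.

Lemma lift_binomialE (l : listing n gamma) I :
  lift_binomial K hgn l I =
  'X_[lift_mnm hgn I (lj l) (lk l)] - 'X_[lift_mnm hgn I (lj' l) (lk' l)].
Proof.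
rewrite /lift_binomial !mpolyXD -!mprodXE.
by under eq_bigr do rewrite x12E; under [X in _ - X * _]eq_bigr do rewrite x12E.
Qed.

(** Comparing the exponents of [c] in the toric images equates the lengths of [lk] and [lk'];
    homogeneity then does so for [lj] and [lj']. *)
Lemma listing_binomial f : F f ->
  [/\ f = 'X_[list_mnm hgn (lj (L f)) (lk (L f))]
          - 'X_[list_mnm hgn (lj' (L f)) (lk' (L f))],
      list_mnm hgn (lj (L f)) (lk (L f))
        != list_mnm hgn (lj' (L f)) (lk' (L f)),
      size (lj (L f)) = size (lj' (L f)) & size (lk (L f)) = size (lk' (L f))].
Proof.
move=> Ff; case: (hL Ff); move: (L f) => l tge tge' fE.
have {}fE: f = 'X_[list_mnm hgn (lj l) (lk l)]
             - 'X_[list_mnm hgn (lj' l) (lk' l)].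
  by rewrite !mpolyXD -!mprodXE.
have [a [b [ab dab fab]]] := hF Ff.
have f0: f != 0.
  apply/eqP => f0; have := mem_msupp_binom K a ab.
  by rewrite -fab f0 eqxx msupp0.
have lab: list_mnm hgn (lj l) (lk l) != list_mnm hgn (lj' l) (lk' l).
  by apply: contraNneq f0 => lE; rewrite fE lE subrr.
have sk: size (lk l) = size (lk' l).
  have := FJ Ff; rewrite fE => /toric_ideal_binomial /mnmP/(_ c).
  by rewrite !toric_list_mnm.
have dE x : x \in msupp f -> mdeg x = mdeg a.
  by rewrite fab mem_msupp_binom // => /orP[]/eqP->.
split=> //; apply/eqP; rewrite -(eqn_add2r (size (lk l))) {2}sk.
by rewrite -!(mdeg_list_mnm hgn) !dE // fE mem_msupp_binom // eqxx ?orbT.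
Qed.

Lemma lifted_family_toric g : FS g -> toric_ideal BS g.
Proof.
case=> [[f [I [Ff sI ->]]]|[j1 [j2 [_ ->]]]].
  have [fE _ sj sk] := listing_binomial Ff.
  rewrite lift_binomialE; apply/toric_ideal_binomial/series_toric_eqP.
  rewrite -!(mdeg_forget hgn) !forget_lift_mnm -?sj //.
  rewrite !mdeg_part2_lift_mnm -?sj // !mdeg_list_mnm sj sk; split=> //.
  by apply/(@toric_ideal_binomial K); rewrite -fE; apply: FJ.
rewrite /x1 /x2 -!mpolyXD; apply/toric_ideal_binomial/series_toric_eqP.
rewrite -!(mdeg_forget hgn) !forgetD !part2D !forget_rshift !forget_lshift.
by rewrite !part2_rshift !part2_lshift !mdegD !mdeg0 !mdeg1 addmC.
Qed.

(** This serves both halves of the theorem. Superscripts are chosen so that the lift [u] of [a]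
    divides [e], and the same ones lift the other monomial. As [a] may be either monomial of [f],
    both signs occur. *)
Lemma lifted_divisor f a (e : 'X_{1..(n + gamma)}) :
  F f -> a \in msupp f -> (a <= forget hgn e)%MM ->
  exists b u v, [/\ b \in msupp f /\
                      (f = 'X_[a] - 'X_[b] \/ f = 'X_[b] - 'X_[a]),
                    forget hgn u = a /\ forget hgn v = b,
                    mdeg (part2 u) = mdeg (part2 v), (u <= e)%MM &
                    a != b /\ (FS ('X_[u] - 'X_[v]) \/ FS ('X_[v] - 'X_[u]))].
Proof.
move=> Ff; have [tge tge' _] := hL Ff.
have [fE ab sj sk] := listing_binomial Ff.
have suppE x : (x \in msupp f) = (x == list_mnm hgn (lj (L f)) (lk (L f)))
    || (x == list_mnm hgn (lj' (L f)) (lk' (L f))).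
  by rewrite {1}fE mem_msupp_binom.
rewrite suppE => /orP[]/eqP-> /lift_mnm_dvd[]// I sI Ie.
  exists (list_mnm hgn (lj' (L f)) (lk' (L f))).
  exists (lift_mnm hgn I (lj (L f)) (lk (L f))).
  exists (lift_mnm hgn I (lj' (L f)) (lk' (L f))).
  rewrite !mdeg_part2_lift_mnm -?sj // !forget_lift_mnm -?sj //; split=> //.
    by split; [rewrite suppE eqxx orbT | left].
  by split=> //; left; left; exists f, I; rewrite lift_binomialE.
exists (list_mnm hgn (lj (L f)) (lk (L f))).
exists (lift_mnm hgn I (lj' (L f)) (lk' (L f))).
exists (lift_mnm hgn I (lj (L f)) (lk (L f))).
rewrite !mdeg_part2_lift_mnm ?sj // !forget_lift_mnm ?sj //; split=> //.
  by split; [rewrite suppE eqxx | right].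
rewrite eq_sym; split=> //; right; left.
by exists f, I; rewrite sj lift_binomialE.
Qed.

End LiftedFamily.

(** * Generators *)

(** Otherwise [v] divides [w], and equal degrees force [v = w]. *)
Lemma mdeg_eq_gt_lt n (v w : 'X_{1..n}) i :
  mdeg v = mdeg w -> (v i < w i)%N -> exists j, (w j < v j)%N.
Proof.
move=> vw vwi; apply/existsP; apply: contraTT vwi.
rewrite negb_exists -leqNgt => /forallP vle.
have {}vle: (v <= w)%MM by apply/mnm_lepP=> j; rewrite leqNgt.
have: mdeg (w - v)%MM = 0%N.
  by apply/eqP; rewrite -(eqn_add2r (mdeg v)) -mdegD submK // vw.
by move/eqP; rewrite mdeg_eq0 -{2}(submK vle) => /eqP->; rewrite add0m.
Qed.

Lemma mdeg_eq_lepm n (v w : 'X_{1..n}) :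
  mdeg v = mdeg w -> (v <= w)%MM -> v = w.
Proof.
move=> vw /mnm_lepP vlew; apply/mnmP=> i; apply/eqP.
rewrite eqn_leq vlew leqNgt; apply/negP => /(mdeg_eq_gt_lt vw)[j].
by rewrite ltnNge vlew.
Qed.

(** * Quadrics exchanging superscripts *)

Section Swap.
Variables (K : fieldType) (n gamma : nat) (hgn : (gamma <= n)%N).
Implicit Types (a b e : 'X_{1..(n + gamma)}) (i j : 'I_gamma).

(** This is x^1_j x^2_i; for [i < j] the quadric is [swap_mnm i j] minus [swap_mnm j i]. *)
Definition swap_mnm i j : 'X_{1..(n + gamma)} :=
  (U_(lshift gamma (widen_ord hgn j)) + U_(rshift n i))%MM.

Lemma part2_swap i j : part2 (swap_mnm i j) = U_(i)%MM.
Proof. by rewrite part2D part2_lshift part2_rshift add0m. Qed.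

Lemma forget_swap i j :
  forget hgn (swap_mnm i j) = forget hgn (swap_mnm j i).
Proof. by rewrite !forgetD !forget_lshift !forget_rshift addmC. Qed.

(** With equal erasures, fewer x^2_j in [a] than in [b] means more x^1_j, hence at least one; and
    [a] has more x^2_i than [b], hence at least one. *)
Lemma swap_dvd a b i j :
  forget hgn a = forget hgn b ->
  (part2 b i < part2 a i)%N -> (part2 a j < part2 b j)%N ->
  (swap_mnm i j <= a)%MM.
Proof.
rewrite !mnmE => /mnmP/(_ (widen_ord hgn j)); rewrite !forget_widen => abj bai.
move=> abj2; apply/mnm_lepP=> k; rewrite mnmDE !mnm1E.
case: (split_ordP k) => l ->; rewrite ?eq_rlshift ?eq_lrshift
  !(inj_eq (@lshift_inj _ _), inj_eq (@rshift_inj _ _)).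
  case: eqP => // <-; rewrite addn0 lt0n; apply: contraTneq abj2 => a0.
  by rewrite -leqNgt; move: abj; rewrite a0 add0n => ->; rewrite leq_addl.
by case: eqP => // <-; apply: leq_trans bai.
Qed.

Lemma swap_lifted (F : {mpoly K[n]} -> Prop) L i j : (i < j)%N ->
  lifted_family hgn F L ('X_[swap_mnm i j] - 'X_[swap_mnm j i]).
Proof. by move=> ij; right; exists i, j; rewrite !mpolyXD. Qed.

End Swap.

Section Congruences.
Variables (K : fieldType) (n gamma : nat) (hgn : (gamma <= n)%N).
Variables (F : {mpoly K[n]} -> Prop) (L : {mpoly K[n]} -> listing n gamma).
Implicit Types (a b e : 'X_{1..(n + gamma)}) (v w : 'X_{1..n}).

Local Notation FS := (lifted_family hgn F L).
Local Notation congr_mnm a b := (ideal_gen FS ('X_[a] - 'X_[b])).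

Lemma congr_swap i j : congr_mnm (swap_mnm hgn i j) (swap_mnm hgn j i).
Proof.
case: (ltngtP i j) => [ij|ji|/val_inj->].
- exact/ideal_gen_mem/swap_lifted.
- by rewrite -opprB; apply/ideal_genN/ideal_gen_mem/swap_lifted.
- by rewrite subrr; apply: ideal_gen0.
Qed.

Lemma congr_mnmD r a b : congr_mnm a b -> congr_mnm (r + a)%MM (r + b)%MM.
Proof. by rewrite !mpolyXD -mulrBr; apply: ideal_genMl. Qed.

Lemma congr_mnm_sym a b : congr_mnm a b -> congr_mnm b a.
Proof. by rewrite -opprB => /ideal_genN; rewrite opprK. Qed.

Lemma congr_mnm_trans b a e : congr_mnm a b -> congr_mnm b e -> congr_mnm a e.
Proof. by move=> ab /(ideal_genD ab); rewrite addrA subrK. Qed.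

(** Induction on the degree of the truncated difference of the x^2-parts. Some [i] is in excess in
    [a] and some [j] in deficit; the quadric exchanging their superscripts lowers that degree. *)
Lemma congr_fibre a b :
  forget hgn a = forget hgn b -> mdeg (part2 a) = mdeg (part2 b) ->
  congr_mnm a b.
Proof.
move: {2}(mdeg _) (leqnn (mdeg (part2 a - part2 b)%MM)) => k.
elim: k a => [|k IHk] a abk fab dab.
  have ab2: part2 a = part2 b.
    apply: mdeg_eq_lepm dab _; apply/mnm_lepP=> i.
    move: abk; rewrite leqn0 mdeg_eq0 => /eqP/mnmP/(_ i)/eqP.
    by rewrite mnmBE mnm0E subn_eq0.
  by rewrite (forget_part2_inj fab ab2) subrr; apply: ideal_gen0.
have [ab2|] := eqVneq (part2 a) (part2 b).
  by rewrite (forget_part2_inj fab ab2) subrr; apply: ideal_gen0.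
have [/(mdeg_eq_lepm dab)-> /eqP//|/mnm_lepP abN _] :=
  boolP (part2 a <= part2 b)%MM.
have [i abi]: exists i, (part2 b i < part2 a i)%N.
  apply/existsP; apply: contra_notT abN => /existsPn abN i.
  by rewrite leqNgt abN.
have [j abj] := mdeg_eq_gt_lt (esym dab) abi.
have ij: (i == j) = false.
  by apply/eqP=> ij; rewrite ij ltnNge ltnW in abi.
have rE := submK (swap_dvd fab abi abj); move: (a - _)%MM rE => r rE.
apply: (@congr_mnm_trans (r + swap_mnm hgn j i)%MM).
  by rewrite -rE; apply/congr_mnmD/congr_swap.
apply: IHk; last 1 first.
- by rewrite -dab -rE !(part2D r) !part2_swap !mdegD !mdeg1.
- rewrite -ltnS; apply: leq_trans abk.
  rewrite -rE !(part2D r) !part2_swap !mdegE (bigD1 i) //=.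
  rewrite [X in (_ < X)%N](bigD1 i) //=.
  move: abi abj; rewrite -rE !(part2D r) !part2_swap.
  rewrite !mnmDE !mnmBE !mnmDE !mnm1E.
  rewrite !eqxx ij (eq_sym j) ij !addn0 => abi abj.
  rewrite -addSn leq_add //.
    by rewrite addn1 ltnS in abi *; rewrite subSn.
  (* At [l = j] the exponent grows by one, but the deficit keeps the truncated difference at
     zero. *)
  apply: leq_sum => l li; rewrite !mnmBE !mnmDE !mnm1E (eq_sym i) (negbTE li).
  case: eqP => [<-|]; rewrite !addn0 //.
  by rewrite addn1 leq_subLR (leq_trans abj) // leq_addr.
- by rewrite -fab -rE !(forgetD _ r) forget_swap.
Qed.

(* A section of [forget] on the monomials of degree [q] in the x^2; by
   [congr_fibre] the choice of lift is irrelevant modulo the lifted family. *)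
Definition lift_to q v : {mpoly K[n + gamma]} :=
  if [pick e : 'X_{1..(n + gamma) < (mdeg v).+1} |
       (forget hgn e == v) && (mdeg (part2 e) == q)] is Some e
  then 'X_[e] else 0.

Lemma lift_toP q v :
  (exists e, [/\ forget hgn e = v, mdeg (part2 e) = q & lift_to q v = 'X_[e]])
  \/ (forall e, forget hgn e = v -> mdeg (part2 e) <> q) /\ lift_to q v = 0.
Proof.
rewrite /lift_to; case: pickP => [e /andP[/eqP ev /eqP eq]|noe].
  by left; exists e.
right; split=> // e ev eq.
(* Erasing keeps the total degree, so the bounded search in [lift_to] misses no lift. *)
have ve: (mdeg e < (mdeg v).+1)%N by rewrite -ev mdeg_forget.
by have := noe (BMultinom ve); rewrite /= ev eq !eqxx.
Qed.

Lemma congr_lift_to q e :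
  mdeg (part2 e) = q -> ideal_gen FS (lift_to q (forget hgn e) - 'X_[e]).
Proof.
move=> eq; case: (lift_toP q (forget hgn e)) => [[e' [ee' e'q ->]]|[]].
  by apply: congr_fibre; rewrite ?e'q.
by move=> /(_ e erefl).
Qed.

(** The second hypothesis handles the default value: if [v] has no lift of x^2-degree [q], neither
    has [w], and both sides are zero. *)
Lemma congr_lift_to_eq q v w :
  (forall e, forget hgn e = v ->
    exists e', [/\ forget hgn e' = w, mdeg (part2 e') = mdeg (part2 e) &
                   congr_mnm e e']) ->
  (forall e, forget hgn e = w ->
    exists e', forget hgn e' = v /\ mdeg (part2 e') = mdeg (part2 e)) ->
  ideal_gen FS (lift_to q v - lift_to q w).
Proof.
move=> vw wv; case: (lift_toP q v) => [[e [ev eq ->]]|[noe ->]].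
  have [e' [e'w e'q ee']] := vw e ev.
  have := congr_lift_to e'q; rewrite e'w eq => we'.
  by have := ideal_genB ee' we'; rewrite opprB addrA subrK.
case: (lift_toP q w) => [[e [ew eq ->]]|[_ ->]].
  by have [e' [/noe + e'q]] := wv e ew; rewrite e'q.
by rewrite subrr; apply: ideal_gen0.
Qed.

End Congruences.

(** * Generation of the toric ideal of the series extension *)

Section LiftedGenerators.
Variables (K : fieldType) (d : nat) (M : matroid 'I_d) (c : 'I_d).
Variables (n gamma : nat) (hgn : (gamma <= n)%N) (B : numbering M n).
Hypothesis hB : forall j : 'I_n, (c \notin B j) = (j < gamma)%N.
Variable F : {mpoly K[n]} -> Prop.
Hypothesis hF : forall f, F f -> homogeneous_binomial f.
Variable L : {mpoly K[n]} -> listing n gamma.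
Hypothesis hL : forall f, F f -> listing_of hgn f (L f).

Local Notation BS := (series_numbering hgn hB).
Local Notation FS := (lifted_family hgn F L).

Section Toric.
Hypothesis FJ : forall f, F f -> toric_ideal B f.

(** A lift [u] of [a] dividing [e] is replaced by the lift [v] of [b] with the same superscripts. *)
Lemma lift_exchange f r a b e :
  F f -> f = 'X_[a] - 'X_[b] \/ f = 'X_[b] - 'X_[a] -> a != b ->
  forget hgn e = (r + a)%MM ->
  exists e', [/\ forget hgn e' = (r + b)%MM, mdeg (part2 e') = mdeg (part2 e) &
                 ideal_gen FS ('X_[e] - 'X_[e'])].
Proof.
move=> Ff fE ab ea.
have suppE x : (x \in msupp f) = (x == a) || (x == b).
  by case: fE => ->; rewrite mem_msupp_binom // 1?eq_sym // orbC.
have [||b' [u [v [[b'f _] [ua vb] uv ue [ab' FSuv]]]]] :=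
  lifted_divisor hB hF hL FJ (a := a) (e := e) Ff.
- by rewrite suppE eqxx.
- by rewrite ea lem_addl.
have bb': b' = b by move: b'f; rewrite suppE eq_sym (negbTE ab') => /eqP.
exists (e - u + v)%MM; split.
- apply: (@addIm _ a); rewrite forgetD vb bb' -[RHS]addmA (addmC b) addmA -ea.
  by rewrite -[in RHS](submK ue) forgetD ua -!addmA (addmC a).
- by rewrite part2D mdegD -uv -mdegD -part2D submK.
- rewrite -{1}(submK ue); apply: congr_mnmD.
  by case: FSuv => /ideal_gen_mem //; apply: congr_mnm_sym.
Qed.

(** By linearity it suffices to treat a monomial times one binomial of [F], whose two terms have
    lifts exchanged by [lift_exchange]. *)
Lemma lift_to_ideal q p :
  ideal_gen F p -> ideal_gen FS (monext (lift_to K hgn q) p).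
Proof.
case=> k [h [s [Fs ->]]]; rewrite linear_sum; apply: ideal_gen_sum => i _ /=.
rewrite [h i]mpolyE mulr_suml linear_sum; apply: ideal_gen_sum => r _ /=.
rewrite -scalerAl linearZ /= -mul_mpolyC; apply: ideal_genMl.
have [a [b [ab _ sE]]] := hF (Fs i).
rewrite sE mulrBr -!mpolyXD linearB /= !monextX.
apply: congr_lift_to_eq => e.
  by apply: lift_exchange (Fs i) _ ab; left.
have ba: b != a by rewrite eq_sym.
case/(lift_exchange (Fs i) (or_intror sE) ba) => e' [e'a e'e _].
by exists e'.
Qed.

(** [p] is a combination of binomials whose two monomials have equal toric image, hence equal
    x^2-degree. Erasing gives binomials of J_M, which lie in the ideal of [F]; lifting back to that
    degree recovers the original ones modulo the lifted family. *)
Lemma lifted_ideal_sub : (forall p, toric_ideal B p -> ideal_gen F p) ->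
  forall p, toric_ideal BS p -> ideal_gen FS p.
Proof.
move=> JF p Jp; have [rep repE ->] := toric_ideal_span Jp.
apply: ideal_gen_sum => a /repE /esym/series_toric_eqP[dab _ ab].
rewrite -mul_mpolyC; apply: ideal_genMl.
have /toric_ideal_binomial -/(_ K)/JF := ab.
move/(lift_to_ideal (mdeg (part2 a))); rewrite linearB /= !monextX => ab'.
have /ideal_genN := congr_lift_to hgn F L (erefl (mdeg (part2 a))).
rewrite opprB => /ideal_genD/(_ ab').
move/ideal_genD/(_ (congr_lift_to hgn F L (esym dab))).
by rewrite !addrA !subrK.
Qed.

End Toric.
End LiftedGenerators.

(** * Initial ideals *)

Section LiftedOrder.
Variables (n gamma : nat) (hgn : (gamma <= n)%N) (le : rel 'X_{1..n}).
Implicit Types (a b : 'X_{1..(n + gamma)}).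

(** The x^2-parts are compared by degree, then lexicographically, so for [i < j] the quadric is led
    by x^1_j x^2_i. *)
Definition lift_order : rel 'X_{1..(n + gamma)} := fun a b =>
  if forget hgn a == forget hgn b then (part2 a <= part2 b)%O
  else le (forget hgn a) (forget hgn b).

Hypothesis le_order : monomial_order le.

Lemma lift_order_forget a b :
  lift_order a b -> le (forget hgn a) (forget hgn b).
Proof.
have [[le_refl _ _ _] _] := le_order.
by rewrite /lift_order; case: eqP => // ->.
Qed.

Lemma lift_order_monomial : monomial_order lift_order.
Proof.
have [[le_refl le_anti le_trans le_total] [le0 leD]] := le_order.
split; [split|split] => [a|a b|b a e|a b|a|a b e].
- by rewrite /lift_order eqxx.
- rewrite /lift_order (eq_sym (forget hgn b)); case: (eqVneq (forget hgn a)).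
    move=> ab /Order.POrderTheory.le_anti ab2.
    exact: forget_part2_inj ab ab2.
  by move=> /eqP ab /le_anti.
- move=> ab be.
  have := le_trans _ _ _ (lift_order_forget ab) (lift_order_forget be).
  move: ab be; rewrite /lift_order.
  (* When the outer erasures agree, antisymmetry of [le] forces the middle one to agree too, leaving
     only the x^2-parts. *)
  case: (eqVneq (forget hgn a) (forget hgn e)) => // <-.
  rewrite (eq_sym (forget hgn b)).
  case: (eqVneq (forget hgn a) (forget hgn b)) => [_|ab leab leba _].
    by move=> ab2 be2 _; apply: Order.POrderTheory.le_trans ab2 be2.
  by case/eqP: ab; apply: le_anti; rewrite leab.
- rewrite /lift_order (eq_sym (forget hgn b)); case: eqP => // _.
  exact: Order.TotalTheory.le_total.
- by rewrite /lift_order forget0 part2_0 le0 le0m if_same.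
- rewrite /lift_order !forgetD eqm_add2r !part2D lemc_add2l.
  by case: eqP => // _; apply: leD.
Qed.

End LiftedOrder.

Lemma leading_binomial (K : fieldType) n (le : rel 'X_{1..n}) u v :
  monomial_order le -> u != v -> le v u ->
  leading_monomial le ('X_[u] - 'X_[v] : {mpoly K[n]}) u /\
  leading_monomial le ('X_[v] - 'X_[u] : {mpoly K[n]}) u.
Proof.
move=> [[le_refl _ _ _] _] uv vu; have vu_neq : v != u by rewrite eq_sym.
split; split; rewrite ?mem_msupp_binom ?eqxx ?orbT // => w;
  by rewrite mem_msupp_binom // => /orP[]/eqP->.
Qed.

Lemma swap_order n gamma (hgn : (gamma <= n)%N) (le : rel 'X_{1..n})
    (i j : 'I_gamma) : (i < j)%N ->
  lift_order hgn le (swap_mnm hgn j i) (swap_mnm hgn i j) /\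
  swap_mnm hgn i j != swap_mnm hgn j i.
Proof.
move=> ij; split.
  rewrite /lift_order forget_swap eqxx !part2_swap; apply: ltW.
  apply/ltmcP; first by rewrite !mdeg1.
  exists i => [k ki|]; rewrite !mnm1E ?eqxx.
    by rewrite -!val_eqE /= !gtn_eqF // (ltn_trans ki).
  by rewrite -val_eqE /= gtn_eqF.
apply: contraTneq ij => /(congr1 (@part2 n gamma)); rewrite !part2_swap => /eqP.
by rewrite eq_mnm1 => /eqP->; rewrite ltnn.
Qed.

Lemma lifted_family_finite (K : fieldType) n gamma (hgn : (gamma <= n)%N)
    (F : {mpoly K[n]} -> Prop) (L : {mpoly K[n]} -> listing n gamma) :
  finite_family F -> finite_family (lifted_family hgn F L).
Proof.
case=> s Fs.
exists ([seq lift_binomial K hgn (L f) (val w)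
          | f <- s, w <- enum {: (size (lj (L f))).-tuple bool}] ++
        (* All pairs are listed, not only the increasing ones, since containment is enough. *)
        [seq x1 K gamma (widen_ord hgn p.2) * x2 K n p.1
             - x1 K gamma (widen_ord hgn p.1) * x2 K n p.2
          | p <- enum {: 'I_gamma * 'I_gamma}]).
move=> g [[f [I [/Fs fs sI ->]]]|[j1 [j2 [_ ->]]]]; rewrite mem_cat.
  apply/orP; left; apply/allpairsPdep.
  by exists f, (Tuple (introT eqP sI)); rewrite mem_enum.
by apply/orP; right; apply/mapP; exists (j1, j2); rewrite ?mem_enum.
Qed.

(** * The Groebner basis property *)

Section Groebner.
Variables (K : fieldType) (d : nat) (M : matroid 'I_d) (c : 'I_d).
Variables (n gamma : nat) (hgn : (gamma <= n)%N) (B : numbering M n).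
Hypothesis hB : forall j : 'I_n, (c \notin B j) = (j < gamma)%N.
Variable F : {mpoly K[n]} -> Prop.
Hypothesis hF : forall f, F f -> homogeneous_binomial f.
Variable L : {mpoly K[n]} -> listing n gamma.
Hypothesis hL : forall f, F f -> listing_of hgn f (L f).
Variable le : rel 'X_{1..n}.
Hypothesis le_order : monomial_order le.

Local Notation BS := (series_numbering hgn hB).
Local Notation FS := (lifted_family hgn F L).
Local Notation leS := (lift_order hgn le).
Implicit Types (p : {mpoly K[n + gamma]}) (m e : 'X_{1..(n + gamma)}).

Lemma ideal_gen_initial_dvd (G : {mpoly K[n + gamma]} -> Prop) g u m :
  G g -> leading_monomial leS g u -> (u <= m)%MM ->
  ideal_gen (initial_monomials leS G) 'X_[m].
Proof.
move=> Gg gu um; rewrite -(submK um) mpolyXD.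
by apply: ideal_genM; exists g, u.
Qed.

(** At the first index [i] where the x^2-parts differ, [m] exceeds [e]; equal degrees give some [j]
    with the opposite inequality, necessarily after [i]. The leading monomial of the quadric for
    [i < j] then divides [m]. *)
Lemma initial_nonminimal m e :
  forget hgn e = forget hgn m -> mdeg (part2 e) = mdeg (part2 m) ->
  (part2 e < part2 m)%O -> ideal_gen (initial_monomials leS FS) 'X_[m].
Proof.
move=> em dem /(ltmcP dem)[i eqi lti].
have [j ltj] := mdeg_eq_gt_lt dem lti.
have ij: (i < j)%N.
  rewrite ltnNge leq_eqVlt; apply/negP=> /orP[/eqP/val_inj ji|/eqi ji].
    by rewrite -ji ltnNge ltnW in lti.
  by rewrite ji ltnn in ltj.
have [leij neij] := swap_order hgn le ij.
have [lead _] :=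
  leading_binomial K (lift_order_monomial hgn le_order) neij leij.
apply: ideal_gen_initial_dvd (swap_lifted hgn F L ij) lead _.
exact: swap_dvd (esym em) lti ltj.
Qed.

Hypothesis FJ : forall f, F f -> toric_ideal B f.

(** The lifted order looks at erasures first, so a lift of the leading monomial of [f] leads the
    lifted binomial; its superscripts are chosen to make it divide [m]. *)
Lemma initial_lifted_dvd f a m :
  F f -> leading_monomial le f a -> (a <= forget hgn m)%MM ->
  ideal_gen (initial_monomials leS FS) 'X_[m].
Proof.
move=> Ff [fa lea] am.
have [b [u [v [[bf _] [ua vb] uv um [ab FSuv]]]]] :=
  lifted_divisor hB hF hL FJ Ff fa am.
have uv_neq: u != v by apply: contraNneq ab => E; rewrite -ua E vb.
have leuv: leS v u by rewrite /lift_order ua vb eq_sym (negbTE ab) lea.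
have [lead1 lead2] :=
  leading_binomial K (lift_order_monomial hgn le_order) uv_neq leuv.
by case: FSuv => FSuv; [apply: ideal_gen_initial_dvd FSuv lead1 um
                       |apply: ideal_gen_initial_dvd FSuv lead2 um].
Qed.

Definition slice q p : {mpoly K[n]} :=
  monext (fun a => if mdeg (part2 a) == q then 'X_[forget hgn a]
                   else 0 : {mpoly K[n]}) p.

(** The two monomials of each spanning binomial have the same x^2-degree, so they are kept or
    dropped together; if kept, their erasures have equal toric image. *)
Lemma slice_toric q p : toric_ideal BS p -> toric_ideal B (slice q p).
Proof.
move=> Jp; have [rep repE ->] := toric_ideal_span Jp.
rewrite /slice linear_sum big_seq; apply: (big_ind (toric_ideal B)).
- by rewrite /toric_ideal toric_mapE linear0.
- exact: toric_idealD.
move=> a /repE /esym/series_toric_eqP[dab _ /(@toric_ideal_binomial K) ab].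
rewrite linearZ /= -mul_mpolyC; apply: toric_idealM.
rewrite linearB /= !monextX -dab; case: eqP => // _.
by rewrite subrr /toric_ideal toric_mapE linear0.
Qed.

Lemma slice_coef q p w :
  (slice q p)@_w =
  \sum_(a <- msupp p | (mdeg (part2 a) == q) && (forget hgn a == w)) p@_a.
Proof.
rewrite /slice /monext raddf_sum [RHS]big_mkcond; apply: eq_bigr => a _ /=.
rewrite mcoeffZ; case: eqP => _ /=; last by rewrite mcoeff0 mulr0.
by rewrite mcoeffX; case: eqP; rewrite ?mulr1 ?mulr0.
Qed.

(** By the second hypothesis only [m] contributes to the coefficient of its erasure, so nothing
    cancels there. *)
Lemma slice_leading p m :
  leading_monomial leS p m ->
  {in msupp p, forall e, forget hgn e = forget hgn m ->
     mdeg (part2 e) = mdeg (part2 m) -> e = m} ->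
  leading_monomial le (slice (mdeg (part2 m)) p) (forget hgn m).
Proof.
move=> [pm lem] minm; split=> [|w].
  rewrite mcoeff_msupp slice_coef -big_filter.
  rewrite (perm_big [:: m]) /=; first by rewrite big_seq1 -mcoeff_msupp.
  apply: uniq_perm; rewrite ?filter_uniq ?msupp_uniq // => e.
  rewrite mem_filter inE; apply/andP/eqP => [[/andP[/eqP dem /eqP em] pe]|->].
    exact: minm.
  by rewrite !eqxx.
rewrite mcoeff_msupp slice_coef big_seq_cond => /eqP pw.
have [/hasP[e pe /andP[_ /eqP <-]]|/hasPn no] := boolP (has (fun a =>
   (mdeg (part2 a) == mdeg (part2 m)) && (forget hgn a == w)) (msupp p)).
  exact/(lift_order_forget le_order)/lem.
by case: pw; rewrite big1 // => e /andP[/no/negbTE->].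
Qed.

Lemma lifted_groebner :
  groebner_basis le (toric_ideal B) F ->
  groebner_basis leS (toric_ideal BS) FS.
Proof.
move=> [finF _ genF]; split.
- exact: lifted_family_finite.
- by move=> f; apply: lifted_family_toric.
move=> p; split; last first.
  apply: sub_ideal_gen => _ [f [a [Ff fa ->]]]; apply: ideal_gen_mem.
  by exists f, a; split=> //; apply: lifted_family_toric Ff.
apply: sub_ideal_gen => _ [f [m [Jf fm ->]]].
(* Another monomial of [f] with the same erasure and x^2-degree as [m] lies below [m], so a quadric
   settles this case; otherwise slicing does not cancel [m]. *)
have [/hasP[e fe /and3P[/eqP em /eqP dem em_neq]]|/hasPn minm] := boolP (has
    (fun e => [&& forget hgn e == forget hgn m,
                  mdeg (part2 e) == mdeg (part2 m) & e != m]) (msupp f)).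
  apply: (initial_nonminimal em dem); rewrite lt_neqAle.
  have := fm.2 e fe; rewrite /lift_order em eqxx => ->; rewrite andbT.
  by apply: contra_neq em_neq; apply: forget_part2_inj.
have lead: leading_monomial le (slice (mdeg (part2 m)) f) (forget hgn m).
  apply: slice_leading fm _ => e /minm + em dem.
  by rewrite em dem !eqxx /= => /negPn/eqP.
have : ideal_gen (initial_monomials le F) 'X_[forget hgn m].
  apply/genF/ideal_gen_mem; exists (slice (mdeg (part2 m)) f), (forget hgn m).
  by split=> //; apply: slice_toric.
(* Membership in a monomial ideal yields a single leading monomial of [F] dividing the erasure of
   [m]. *)
case/ideal_gen_monomial_dvd => [_ [g [a [_ _ ->]]]|]; first by exists a.
move=> a [g [b [Fg gb /mpolyX_inj ->]]].
exact: initial_lifted_dvd gb.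
Qed.

End Groebner.

Theorem theorem2p4 (K : fieldType) (d : nat) (M : matroid 'I_d) (c : 'I_d)
    (hc : ~ coloop M c)
    (n gamma : nat) (hgn : (gamma <= n)%N) (B : numbering M n)
    (hB : forall j : 'I_n, (c \notin B j) = (j < gamma)%N)
    (F : {mpoly K[n]} -> Prop)
    (hF : forall f, F f -> homogeneous_binomial f)
    (L : {mpoly K[n]} -> listing n gamma)
    (hL : forall f, F f -> listing_of hgn f (L f)) :
  (generates (@toric_ideal K d M n B) F ->
   generates (@toric_ideal K d.+1 (series_extension M c) (n + gamma)
                (series_numbering hgn hB))
     (lifted_family hgn F L)) /\
  ((exists le : rel 'X_{1..n},
      monomial_order le /\ groebner_basis le (@toric_ideal K d M n B) F) ->
   exists le : rel 'X_{1..(n + gamma)},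
     monomial_order le /\
     groebner_basis le
       (@toric_ideal K d.+1 (series_extension M c) (n + gamma)
          (series_numbering hgn hB))
       (lifted_family hgn F L)).
Proof.
split=> [genF|[le [le_order grF]]].
  have FJ f : F f -> toric_ideal B f by move=> Ff; apply/genF/ideal_gen_mem.
  move=> p; split; first by apply: lifted_ideal_sub => // q /genF.
  by apply: ideal_gen_sub_toric => g; apply: lifted_family_toric.
exists (lift_order hgn le); split; first exact: lift_order_monomial.
by apply: lifted_groebner => //; case: grF.
Qed.
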